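(* Let $R$ be a commutative noetherian ring and let $\mathcal{S}$ be a Serre subcategory of $R\text{-}\mathrm{Mod}$. Then $$\{ \mathfrak{p} \in \mathbb{M}[\mathcal{S}_{f.g.} * \mathcal{S}] \mid \mathrm{ht}\, \mathfrak{p} \geq 1 \} \subseteq \{ \mathfrak{p} \in \mathrm{Supp}_R(\mathcal{S}) \mid \mathrm{ht}\, \mathfrak{p} \geq 1 \}.$$ Moreover, if $\mathcal{S}$ is closed under taking injective hulls, then $$\{ \mathfrak{p} \in \mathbb{M}[\mathcal{S}_{f.g.} * \mathcal{S}] \mid \mathrm{ht}\, \mathfrak{p} \geq 1 \} = \{ \mathfrak{p} \in \mathrm{Supp}_R(\mathcal{S}) \mid \mathrm{ht}\, \mathfrak{p} \geq 1 \}.$$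
   Context: All rings are commutative noetherian and all modules are unitary. $R\text{-}\mathrm{Mod}$ is the category of all $R$-modules; subcategories are full and closed under isomorphisms. A Serre subcategory of $R\text{-}\mathrm{Mod}$ is a (nonempty) subcategory closed under taking submodules, quotient modules and extensions. For an ideal $I$ of $R$ and an $R$-module $M$, $\Gamma_I(M)=\{x\in M \mid I^n x=0 \text{ for some } n\geq 1\}$ and $(0:_M I)=\{x\in M\mid Ix=0\}$. A Serre subcategory $\mathcal{S}$ satisfies the Melkersson condition $(C_I)$ if: for every $R$-module $M$, if $\Gamma_I(M)=M$ and $(0:_M I)\in\mathcal{S}$, then $M\in\mathcal{S}$. Put $\mathbb{M}[\mathcal{S}]=\{\mathfrak{p}\in\mathrm{Spec}(R)\mid \mathcal{S}\text{ satisfies }(C_{\mathfrak{p}})\}$. For a subcategory $\mathcal{X}$, $\mathrm{Supp}_R(\mathcal{X})=\bigcup_{M\in\mathcal{X}}\mathrm{Supp}_R(M)$. $\mathcal{S}_{f.g.}$ is the subcategory of finitely generated $R$-modules. For Serre subcategories $\mathcal{S}_1,\mathcal{S}_2$, $\mathcal{S}_1*\mathcal{S}_2$ is the subcategory of $R$-modules $M$ for which there is a short exact sequence $0\to S_1\to M\to S_2\to 0$ with $S_i\in\mathcal{S}_i$. It is known that $\mathcal{S}_{f.g.}*\mathcal{S}$ is a Serre subcategory for every Serre subcategory $\mathcal{S}$. *)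

(* Defs.v *)
From HB Require Import structures.
From mathcomp Require Import all_boot all_order all_algebra.
From mathcomp Require Import boolp classical_sets.

Set Implicit Arguments.
Unset Strict Implicit.
Unset Printing Implicit Defensive.

Import GRing.Theory.
Local Open Scope classical_set_scope.
Local Open Scope ring_scope.

(* Rings are [comPzRingType], so the zero ring is allowed.  Ideals are Prop-valued
   sets, since the [idealr] predicates of MathComp are proper by definition.
   A full subcategory of R-Mod is a predicate on [lmodType R]. *)

Section Submodules.
Variables (R : comPzRingType) (M : lmodType R).

Definition submodule (N : set M) : Prop :=
  [/\ N 0, forall x y, N x -> N y -> N (x + y) & forall a x, N x -> N (a *: x)].

Definition finitely_generated : Prop :=
  exists (n : nat) (g : 'I_n -> M),
    forall x : M, exists c : 'I_n -> R, x = \sum_(i < n) c i *: g i.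

End Submodules.

Arguments finitely_generated {R} M.

Section Ideals.
Variable R : comPzRingType.
Implicit Types I J p : set R.

Definition ideal I : Prop :=
  [/\ I 0, forall a b, I a -> I b -> I (a + b) & forall r a, I a -> I (r * a)].

Definition noetherian : Prop :=
  forall I, ideal I -> exists (n : nat) (g : 'I_n -> R),
    I = [set a | exists c : 'I_n -> R, a = \sum_(i < n) c i * g i].

Definition prime_ideal p : Prop :=
  [/\ ideal p, ~ p 1 & forall a b, p (a * b) -> p a \/ p b].

Definition ideal_gen (A : set R) : set R :=
  [set a | forall I, ideal I -> A `<=` I -> I a].

Definition ideal_mul I J : set R :=
  ideal_gen [set c | exists a b, [/\ I a, J b & c = a * b]].

Definition ideal_exp I (n : nat) : set R := iter n (ideal_mul I) [set: R].

(* q is a strictly increasing chain q 0, ..., q m of primes with q m = p. *)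
Definition prime_chain_to p (m : nat) (q : nat -> set R) : Prop :=
  [/\ forall i, (i <= m)%N -> prime_ideal (q i),
      forall i, (i < m)%N -> q i `<` q i.+1
    & q m = p].

(* [height_ge p n] is "ht p >= n", the height being the supremum (possibly
   infinite) of the lengths m of such chains. *)
Definition height_ge p (n : nat) : Prop :=
  exists (m : nat) (q : nat -> set R), (n <= m)%N /\ prime_chain_to p m q.

End Ideals.

Arguments noetherian : clear implicits.

Section Exactness.
Variable R : comPzRingType.

Definition short_exact (A B C : lmodType R)
    (f : {linear A -> B}) (g : {linear B -> C}) : Prop :=
  [/\ injective f, range f = g @^-1` [set 0] & range g = [set: C]].

Definition injective_module (E : lmodType R) : Prop :=
  forall (A B : lmodType R) (i : {linear A -> B}) (g : {linear A -> E}),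
    injective i -> exists h : {linear B -> E}, forall a, h (i a) = g a.

Definition essential (M E : lmodType R) (f : {linear M -> E}) : Prop :=
  injective f /\
  forall N : set E, submodule N -> N `&` range f = [set 0] -> N = [set 0].

Definition injective_hull (M E : lmodType R) (f : {linear M -> E}) : Prop :=
  injective_module E /\ essential f.

End Exactness.

Section Subcategories.
Variable R : comPzRingType.
Implicit Types X Y : lmodType R -> Prop.

Record serre X : Prop := Serre {
  serre_nonempty : exists M : lmodType R, X M;
  serre_iso : forall (M N : lmodType R) (f : {linear M -> N}),
    bijective f -> X M -> X N;
  serre_sub : forall (N M : lmodType R) (f : {linear N -> M}),
    injective f -> X M -> X N;
  serre_quot : forall (M N : lmodType R) (f : {linear M -> N}),
    range f = [set: N] -> X M -> X N;
  serre_ext : forall (A B C : lmodType R)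
      (f : {linear A -> B}) (g : {linear B -> C}),
    short_exact f g -> X A -> X C -> X B
}.

Definition extension_subcat X Y (M : lmodType R) : Prop :=
  exists (A B : lmodType R) (f : {linear A -> M}) (g : {linear M -> B}),
    [/\ short_exact f g, X A & Y B].

Definition Sfg (M : lmodType R) : Prop := finitely_generated M.

Definition closed_injective_hull X : Prop :=
  forall (M E : lmodType R) (f : {linear M -> E}),
    injective_hull f -> X M -> X E.

End Subcategories.

Section Torsion.
Variables (R : comPzRingType) (I : set R) (M : lmodType R).

Definition Gamma : set M :=
  [set x | exists n : nat, (1 <= n)%N /\ forall a, ideal_exp I n a -> a *: x = 0].

Definition colon : set M := [set x | forall a, I a -> a *: x = 0].

Definition colon_pred : {pred M} := fun x => `[< colon x >].

Fact colon_submod_closed : submod_closed colon_pred.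
Proof.
split=> [|r x y /asboolP Hx /asboolP Hy].
  by apply/asboolP => a _; rewrite scaler0.
apply/asboolP => a Ia.
by rewrite scalerDr scalerA mulrC -scalerA Hx // Hy // scaler0 addr0.
Qed.

HB.instance Definition _ :=
  GRing.isSubmodClosed.Build R M colon_pred colon_submod_closed.

(* The submodule (0 :_M I) as an R-module in its own right. *)
Record colon_module := ColonModule {
  colon_val :> M;
  colon_valP : colon_val \in colon_pred
}.

HB.instance Definition _ := [isSub for colon_val].
HB.instance Definition _ := [Choice of colon_module by <:].
HB.instance Definition _ := [SubChoice_isSubLmodule of colon_module by <:].

End Torsion.

Arguments Gamma {R} I M.
Arguments colon {R} I M.
Arguments colon_module {R} I M.

Section Support.
Variables (R : comPzRingType) (p : set R) (M : lmodType R).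

(* The localization M_p is the set of fractions x / s, with s outside p, modulo
   [frac_eq]. *)
Definition frac : Type := (M * {s : R | ~ p s})%type.

Definition frac_eq (u v : frac) : Prop :=
  exists t : R, ~ p t /\
    t *: (sval v.2 *: u.1 - sval u.2 *: v.1) = 0.

Definition localization_nonzero : Prop :=
  exists u v : frac, ~ frac_eq u v.

End Support.

Section Spectrum.
Variable R : comPzRingType.
Implicit Types X : lmodType R -> Prop.

Definition melkersson X (I : set R) : Prop :=
  forall M : lmodType R,
    Gamma I M = [set: M] -> X (colon_module I M) -> X M.

Definition MM X : set (set R) := [set p | prime_ideal p /\ melkersson X p].

Definition Supp (M : lmodType R) : set (set R) :=
  [set p | prime_ideal p /\ localization_nonzero p M].

Definition Supp_subcat X : set (set R) :=
  [set p | exists M : lmodType R, X M /\ Supp M p].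

End Spectrum.

(* Main.v *)
Require Import Defs.
From HB Require Import structures.
From mathcomp Require Import all_boot all_order all_algebra.
From mathcomp Require Import boolp classical_sets functions.

(* For the inclusion, suppose that p is not in Supp S and let E be the injective hull of
   R/p.  By Zorn there is a submodule N of E, maximal among those meeting (0 :_E p) in
   R/p.  It is p-torsion and (0 :_N p) = R/p is finitely generated, so N lies in S_fg * S.
   By maximality N and E have the same localization at p, and modules of S vanish there,
   so E_p is finitely generated, hence killed by some p^n.  Since E_p is faithful over R_p,
   p^n R_p = 0, and p lies in every prime contained in p: the height of p is 0.

   For the converse, p in Supp S gives R/p in S.  If M is p-torsion and (0 :_M p) is in
   S_fg * S, its finitely generated part is killed by p, hence in S, so (0 :_M p) is in S.
   As M is essential over (0 :_M p), the injective hull of M is one of (0 :_M p), so it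
   is in S.

   Injective hulls are built inside Hom_Z(R, D), with D a power of Q/Z.  Homomorphisms are
   extended by means of their graphs: a submodule of B * E in which only (0, 0) lies over 0
   is the graph of a partial linear map. *)

Set Implicit Arguments.
Unset Strict Implicit.
Unset Printing Implicit Defensive.

Import Order.TTheory GRing.Theory Num.Theory.
Local Open Scope classical_set_scope.
Local Open Scope ring_scope.
Local Open Scope quotient_scope.

(** * Submodules, quotients and Serre subcategories *)

Section Subobjects.
Variables (R : comPzRingType) (M : lmodType R) (N : set M).
Hypothesis hN : submodule N.

(** The proof of [submodule N] is an argument so that the closure instance below can be inferred
    from the term [sub_pred hN]. *)
Definition sub_pred of submodule N : {pred M} := fun x => `[< N x >].

Fact sub_pred_closed : submod_closed (sub_pred hN).
Proof.
case: hN => N0 ND NZ; split=> [|a x y /asboolP Nx /asboolP Ny]; apply/asboolP => //.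
by apply: ND => //; apply: NZ.
Qed.

HB.instance Definition _ :=
  GRing.isSubmodClosed.Build R M (sub_pred hN) sub_pred_closed.

Record sub_module := SubModule { sub_val : M; sub_valP : sub_val \in sub_pred hN }.

HB.instance Definition _ := [isSub for sub_val].
HB.instance Definition _ := [Choice of sub_module by <:].
HB.instance Definition _ := [SubChoice_isSubLmodule of sub_module by <:].

Definition sub_incl : {linear sub_module -> M} := \val.

Lemma sub_incl_inj : injective sub_incl.
Proof. exact: val_inj. Qed.

Lemma sub_inclP x : N (sub_incl x).
Proof. by case: x => x /= /asboolP. Qed.

Lemma range_sub_incl : range sub_incl = N.
Proof.
apply/seteqP; split=> [_ [x _ <-]|x Nx]; first exact: sub_inclP.
have Px : x \in sub_pred hN by apply/asboolP.
by exists (SubModule Px).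
Qed.

(** The quotient of additive groups, under an alias that receives the scalar action through
    representatives. *)
Definition quot_module : Type := Quotient.quot (sub_pred hN).

HB.instance Definition _ := GRing.Zmodule.on quot_module.

Definition quot_mk (x : M) : quot_module :=
  \pi_(Quotient.quot (sub_pred hN)) x.

Lemma quot_mk_surj (q : quot_module) : exists x, quot_mk x = q.
Proof. by exists (repr (q : Quotient.quot (sub_pred hN))); rewrite /quot_mk reprK. Qed.

Lemma quot_mk_eq x y : quot_mk x = quot_mk y <-> N (x - y).
Proof.
rewrite /quot_mk; split=> [/eqP|Nxy].
  by rewrite -Quotient.idealrBE => /asboolP.
by apply/eqP; rewrite -Quotient.idealrBE; apply/asboolP.
Qed.

Lemma quot_mkD x y : quot_mk (x + y) = quot_mk x + quot_mk y.
Proof. exact: (raddfD \pi_(Quotient.quot (sub_pred hN))). Qed.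

Definition quot_scale (a : R) (q : quot_module) : quot_module :=
  quot_mk (a *: repr (q : Quotient.quot (sub_pred hN))).

Lemma quot_mkZ a x : quot_scale a (quot_mk x) = quot_mk (a *: x).
Proof.
apply/quot_mk_eq; rewrite -scalerBr; have [_ _] := hN; apply.
by apply/quot_mk_eq; rewrite /quot_mk reprK.
Qed.

Fact quot_scalerA a b q : quot_scale a (quot_scale b q) = quot_scale (a * b) q.
Proof. by have [x <-] := quot_mk_surj q; rewrite !quot_mkZ scalerA. Qed.

Fact quot_scale1r : left_id 1 quot_scale.
Proof. by move=> q; have [x <-] := quot_mk_surj q; rewrite quot_mkZ scale1r. Qed.

Fact quot_scalerDr : right_distributive quot_scale +%R.
Proof.
move=> a q r; have [x <-] := quot_mk_surj q; have [y <-] := quot_mk_surj r.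
by rewrite -quot_mkD !quot_mkZ scalerDr quot_mkD.
Qed.

Fact quot_scalerDl q : {morph quot_scale^~ q : a b / a + b}.
Proof.
move=> a b; have [x <-] := quot_mk_surj q.
by rewrite !quot_mkZ scalerDl quot_mkD.
Qed.

HB.instance Definition _ := GRing.Zmodule_isLmodule.Build R quot_module
  quot_scalerA quot_scale1r quot_scalerDr quot_scalerDl.

Fact quot_mk_linear : linear quot_mk.
Proof. by move=> a x y; rewrite quot_mkD -quot_mkZ. Qed.

HB.instance Definition _ :=
  GRing.isLinear.Build R M quot_module _ quot_mk quot_mk_linear.

Lemma quot_mk_eq0 x : quot_mk x = 0 <-> N x.
Proof. by rewrite -(raddf0 quot_mk) quot_mk_eq subr0. Qed.

End Subobjects.

Definition linear_of (R : comPzRingType) (A B : lmodType R) (f : A -> B)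
    (hf : linear f) : {linear A -> B} :=
  HB.pack f (GRing.isLinear.Build R A B _ f hf).

(** By the last hypothesis [G] projects injectively to [B]; its projection to [E] extends along that
    injection. *)
Lemma injective_graph_extension (R : comPzRingType) (B E : lmodType R)
    (G : set (B * E)) :
    injective_module E -> submodule G -> (forall y, G (0, y) -> y = 0) ->
  exists h : {linear B -> E}, forall b e, G (b, e) -> h b = e.
Proof.
move=> injE hG G0.
pose i : {linear sub_module hG -> B} := fst \o sub_incl hG.
pose g : {linear sub_module hG -> E} := snd \o sub_incl hG.
have inj_i : injective i.
  apply: raddf_inj => x ix0; apply: (@sub_incl_inj _ _ _ hG).
  have := sub_inclP x; rewrite raddf0.
  move: ix0; rewrite /i /=; case: (val x) => b e /= -> /G0 -> //.
have [h hi] := injE _ _ i g inj_i; exists h => b e Gbe.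
have : range (sub_incl hG) (b, e) by rewrite range_sub_incl.
by case=> x _ /= xE; have := hi x; rewrite /i /g /= xE.
Qed.

Section Serre.
Variables (R : comPzRingType) (S : lmodType R -> Prop).
Hypothesis hS : serre S.

(* [G] presents [B] as a quotient of a submodule of [A]. *)
Lemma serre_subquotient (A B : lmodType R) (G : set (A * B)) :
    submodule G -> (forall y, G (0, y) -> y = 0) ->
    (forall b, exists a, G (a, b)) -> S A -> S B.
Proof.
move=> hG G0 Gsurj SA.
pose i : {linear sub_module hG -> A} := fst \o sub_incl hG.
pose g : {linear sub_module hG -> B} := snd \o sub_incl hG.
have inj_i : injective i.
  apply: raddf_inj => x ix0; apply: (@sub_incl_inj _ _ _ hG).
  have := sub_inclP x; rewrite raddf0.
  move: ix0; rewrite /i /=; case: (val x) => b e /= -> /G0 -> //.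
apply: (serre_quot hS (f := g)); last exact: (serre_sub hS inj_i).
apply/seteqP; split=> // b _; have [a Gab] := Gsurj b.
have : range (sub_incl hG) (a, b) by rewrite range_sub_incl.
by case=> x _ /= xE; exists x => //; rewrite /g /= xE.
Qed.

Lemma serre_zero (Z : lmodType R) : (forall z : Z, z = 0) -> S Z.
Proof.
move=> Z0; have [M SM] := serre_nonempty hS.
apply: (@serre_subquotient M Z [set u | u.1 = 0]) SM.
- split=> [|[x y] [z t] /= -> ->|a [x y] /= ->] //=; first by rewrite addr0.
  by rewrite scaler0.
- by move=> y _; apply: Z0.
- by move=> z; exists 0.
Qed.

Lemma serre_prod (A B : lmodType R) : S A -> S B -> S (A * B)%type.
Proof.
move=> SA SB.
pose f (x : A) : A * B := (x, 0).
have flin : linear f.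
  by move=> a x y; congr (_, _); rewrite /= scaler0 addr0.
apply: (serre_ext hS (f := linear_of flin)
                     (g := snd : {linear (A * B)%type -> B})) => //.
split.
- by move=> x y [].
- apply/seteqP; split=> [_ [x _ <-] //|[x y] /= ->]; by exists x.
- by apply/seteqP; split=> // y _; exists (0, y).
Qed.

Lemma serre_power (Q : lmodType R) n : S Q -> S ('I_n -> Q).
Proof.
move=> SQ; elim: n => [|n IH].
  by apply: serre_zero => z; apply/funext => -[].
(* The relation is the graph of the isomorphism of Q x Q^n with Q^(n+1). *)
apply: (@serre_subquotient _ _
  [set u : (Q * ('I_n -> Q)) * ('I_n.+1 -> Q) |
     u.2 ord0 = u.1.1 /\ forall i, u.2 (lift ord0 i) = u.1.2 i]);
  last exact: serre_prod SQ IH.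
- split=> [|[x y] [z t] /= [h0 h1] [h0' h2]|a [x y] /= [h0 h1]] //=.
  + by split=> [|i]; rewrite !fctE ?h0 ?h0' ?h1 ?h2.
  + by split=> [|i]; rewrite !fctE ?h0 ?h1.
- move=> y /= [y0 yS]; apply/funext=> i.
  by have [j ->|->] := unliftP ord0 i.
- by move=> b; exists (b ord0, fun i => b (lift ord0 i)).
Qed.

End Serre.

(** * Divisible groups *)

Section Zorn.
Variable T : Type.
Implicit Types (F P : set (set T)) (A B X : set T).

(** Zorn's lemma is applied to the sets whose union with [A] satisfies [P]. The empty chain is then
    settled by [P A]. *)
Lemma zorn_above P A : P A ->
    (forall F, F `<=` P -> total_on F subset -> F !=set0 ->
      P (\bigcup_(X in F) X)) ->
  exists B, [/\ A `<=` B, P B & forall C, B `<=` C -> P C -> C = B].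
Proof.
move=> PA Pchain.
have [|X [PX maxX]] := @Zorn_bigcup T [set X | P (A `|` X)].
  move=> F FP Ftot; have [F0|/set0P/negP/negPn/eqP->] := pselect (F !=set0); last first.
    by rewrite /= bigcup_set0 setU0.
  have -> : [set X | P (A `|` X)] (\bigcup_(X in F) X) =
            P (\bigcup_(X in [set A `|` Y | Y in F]) X).
    rewrite /= bigcup_image; congr P; apply/seteqP; split=> x.
      case=> [Ax|[X FX Xx]]; last by exists X => //; right.
      by have [X FX] := F0; exists X => //; left.
    by case=> X FX [Ax|Xx]; [left|right; exists X].
  apply: Pchain.
  - by move=> _ [X FX <-]; apply: FP.
  - move=> _ _ [X FX <-] [Y FY <-].
    by have [XY|YX] := Ftot _ _ FX FY; [left|right]; exact: setUS.
  - by have [X FX] := F0; exists (A `|` X), X.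
exists (A `|` X); split=> [x Ax||C AXC PC]; [by left|by []|].
have XC : X `<=` C by move=> x Xx; apply: AXC; right.
have AC : A `|` C = C by apply: setUidr => x Ax; apply: AXC; left.
have [XC'|nXC] := pselect (X = C).
  by apply/seteqP; split=> // x; rewrite -XC'; right.
by case: (maxX C); rewrite /= ?AC //; split=> // CX; apply: nXC; apply/seteqP.
Qed.

Lemma bigcup_chain2 F x y : total_on F subset ->
    (\bigcup_(X in F) X) x -> (\bigcup_(X in F) X) y ->
  exists X, [/\ F X, X x & X y].
Proof.
move=> Ftot [X FX Xx] [Y FY Yy].
by have [XY|YX] := Ftot _ _ FX FY; [exists Y|exists X]; split=> //; [exact: XY|exact: YX].
Qed.

End Zorn.

Definition subgroup (V : zmodType) (N : set V) : Prop :=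
  N 0 /\ forall x y, N x -> N y -> N (x - y).

Lemma subgroupN (V : zmodType) (N : set V) x : subgroup N -> N x -> N (- x).
Proof. by move=> [N0 NB] Nx; rewrite -sub0r; apply: NB. Qed.

Lemma subgroupD (V : zmodType) (N : set V) x y :
  subgroup N -> N x -> N y -> N (x + y).
Proof.
by move=> hN Nx Ny; rewrite -[y]opprK; have [_] := hN; apply=> //; apply: subgroupN.
Qed.

Lemma subgroupMz (V : zmodType) (N : set V) x k : subgroup N -> N x -> N (x *~ k).
Proof.
move=> hN Nx; have Nn n : N (x *+ n).
  elim: n => [|n IH]; first by rewrite mulr0n; case: hN.
  by rewrite mulrS; apply: subgroupD.
by case: k => n; [exact: Nn|apply: subgroupN (Nn _)].
Qed.

Lemma subgroup_bigcup (V : zmodType) (F : set (set V)) :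
    (forall X, F X -> subgroup X) -> total_on F subset -> F !=set0 ->
  subgroup (\bigcup_(X in F) X).
Proof.
move=> Fsub Ftot [X FX]; split; first by exists X => //; case: (Fsub X FX).
move=> x y Ux Uy; have [Y [FY Yx Yy]] := bigcup_chain2 Ftot Ux Uy.
by exists Y => //; have [_] := Fsub Y FY; apply.
Qed.

(** The generator is the least positive element of [I], or 0 if there is none. *)
Lemma int_subgroup_principal (I : set int) : subgroup I ->
  exists n : nat, I n%:Z /\ forall k, I k -> exists q, k = q * n%:Z.
Proof.
move=> hI; have [I0 IB] := hI.
pose P n := (0 < n)%N && `[< I n%:Z >].
have Pabs k : I k -> k != 0 -> P `|k|%N.
  move=> Ik k0; rewrite /P absz_gt0 k0; apply/asboolP.
  by rewrite abszE; case: (ger0P k) => // _; apply: subgroupN.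
have [exP|nexP] := pselect (exists n, P n); last first.
  exists 0%N; split=> // k Ik; exists 0; rewrite mulr0.
  by apply: contrapT => /eqP k0; apply: nexP; exists `|k|%N; apply: Pabs.
case: (ex_minnP exP) => n /andP[n0 /asboolP In] minn; exists n; split=> // k Ik.
exists (k %/ n%:Z)%Z.
have r_ge0 : 0 <= (k %% n%:Z)%Z by rewrite modz_ge0 // eqz_nat -lt0n.
have : I (k %% n%:Z)%Z.
  rewrite /modz; apply: IB => //.
  by rewrite mulrC -mulrzz; apply: (subgroupMz _ hI In).
have [/eqP r0 _|r0 /Pabs /(_ r0) /minn] := boolP ((k %% n%:Z)%Z == 0).
  by rewrite [LHS](divz_eq k n%:Z) r0 addr0.
rewrite leqNgt -ltz_nat abszE ger0_norm // ltz_mod //.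
by rewrite eqz_nat -lt0n.
Qed.

Definition divisible (D : zmodType) : Prop :=
  forall n (y : D), (0 < n)%N -> exists x, x *+ n = y.

Definition additive_of (A B : zmodType) (f : A -> B)
    (hf : zmod_morphism f) : {additive A -> B} :=
  HB.pack f (GRing.isZmodMorphism.Build A B f hf).

(** Zorn enlarges [G] to a maximal graph [H]; as a value at any [b] can be adjoined to [H], its
    domain is all of [B]. *)
Lemma divisible_graph_extension (B D : zmodType) (G : set (B * D)) :
    divisible D -> subgroup G -> (forall y, G (0, y) -> y = 0) ->
  exists h : {additive B -> D}, forall b d, G (b, d) -> h b = d.
Proof.
move=> divD hG G0.
pose P := [set H : set (B * D) | subgroup H /\ forall y, H (0, y) -> y = 0].
have [//|F FP Ftot F0|H [GH [hH H0] maxH]] := @zorn_above _ P G.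
  split; first by apply: subgroup_bigcup => // X /FP[].
  by move=> y [X FX]; apply: (FP X FX).2.
have Hfun b d d' : H (b, d) -> H (b, d') -> d = d'.
  move=> Hd Hd'; apply/eqP; rewrite -subr_eq0; apply/eqP/H0.
  by rewrite -(subrr b); exact: (hH.2 (b, d) (b, d')).
have HMz b d k : H (b, d) -> H (b *~ k, d *~ k).
  move=> /(subgroupMz k hH).
  have -> u : u *~ k = (u.1 *~ k, u.2 *~ k) :> B * D.
    by rewrite -(raddfMz fst) -(raddfMz snd); case: (u *~ k).
  by [].
have total b : exists d, H (b, d).
  have hI : subgroup [set k | exists d, H (b *~ k, d)].
    split; first by exists 0; rewrite mulr0z; case: hH.
    move=> j k [d Hd] [d' Hd']; exists (d - d'); rewrite mulrzBr.
    exact: (hH.2 (_, _) (_, _)).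
  have [n [[d0 Hd0] In]] := int_subgroup_principal hI.
  (* The value [e] at [b] must satisfy [e *~ n = d0]. Divisibility gives one if [n > 0]; for
     [n = 0], [d0] is forced to be 0 and 0 is taken. *)
  have [e eP] : exists e, e *~ n%:Z = d0.
    case: n Hd0 {In} => [|n]; last by move=> _; apply: divD.
    by rewrite mulr0z => /H0 ->; exists 0; rewrite mulr0z.
  have He k d : H (b *~ k, d) -> d = e *~ k.
    move=> Hkd; have [|q kE] := In k; first by exists d.
    have := HMz _ _ q Hd0; rewrite -!mulrzA -[_ * q]mulrC -kE => /(Hfun _ _ _ Hkd) ->.
    by rewrite -eP -mulrzA mulrC -kE.
  pose H' := [set u | exists k v, H v /\ u = (v.1 + b *~ k, v.2 + e *~ k)].
  have <- : H' = H.
    apply: maxH.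
    - by move=> [x y] Hxy; exists 0, (x, y); rewrite !mulr0z !addr0.
    - split; first split.
      + by exists 0, 0; rewrite !mulr0z !addr0; split=> //; case: hH.
      + move=> _ _ [j [v [Hv ->]]] [k [w [Hw ->]]]; exists (j - k), (v - w).
        split; first exact: hH.2.
        by rewrite !mulrzBr; congr (_, _); rewrite /= opprD addrACA.
      (* A pair over 0 puts [b *~ k] in the domain of [H], where [He] identifies its value with
         [e *~ k]. *)
      + move=> y [k [[v w] /= [Hvw [+ ->]]]] => /esym/eqP.
        rewrite addrC addr_eq0 => /eqP bk.
        have /He <- : H (b *~ k, - w) by rewrite bk; exact: (subgroupN hH Hvw).
        by rewrite subrr.
  exists e, 1, 0; rewrite !mulr1z !add0r; split=> //; by case: hH.
have [h hP] := choice total.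
have hadd : zmod_morphism h.
  move=> x y; apply: (Hfun (x - y)); first exact: hP.
  exact: (hH.2 (x, h x) (y, h y)).
exists (additive_of hadd) => b d /GH; exact: Hfun.
Qed.

(** * Enough injectives *)

Definition rat_int : {pred rat} := fun x => x \is a Num.int.

Fact rat_int_zmod_closed : zmod_closed rat_int.
Proof. by split=> [|x y]; [exact: rpred0|exact: rpredB]. Qed.

HB.instance Definition _ :=
  GRing.isZmodClosed.Build rat rat_int rat_int_zmod_closed.

Definition rat_mod_int : Type := Quotient.quot rat_int.
HB.instance Definition _ := GRing.Zmodule.on rat_mod_int.

Definition rat_class (x : rat) : rat_mod_int := \pi_(Quotient.quot rat_int) x.

Fact rat_class_zmod_morphism : zmod_morphism rat_class.
Proof. exact: (raddfB \pi_(Quotient.quot rat_int)). Qed.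

HB.instance Definition _ :=
  GRing.isZmodMorphism.Build rat rat_mod_int rat_class rat_class_zmod_morphism.

Lemma rat_class_eq0 x : rat_class x = 0 <-> x \is a Num.int.
Proof.
rewrite -(raddf0 rat_class) -{2}[x]subr0 /rat_class; split=> [/eqP|Nxy].
  by rewrite -Quotient.idealrBE.
by apply/eqP; rewrite -Quotient.idealrBE.
Qed.

Lemma divisible_rat_mod_int : divisible rat_mod_int.
Proof.
move=> n y n0; pose x := repr (y : Quotient.quot rat_int).
have xy : rat_class x = y by rewrite /rat_class reprK.
exists (rat_class (x / n%:R)); rewrite -raddfMn -[_ / _ *+ n]mulr_natr divfK //.
by rewrite pnatr_eq0 -lt0n.
Qed.

Lemma divisible_fun (T : Type) (D : zmodType) : divisible D -> divisible (T -> D).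
Proof.
move=> divD n y n0.
have [x xP] := choice (fun t => divD n (y t) n0).
by exists x; apply/funext=> t; rewrite natmulfctE xP.
Qed.

(** A character of the cyclic subgroup generated by [m], nonzero at [m], extends to [M] because Q/Z
    is divisible. *)
Lemma exists_character (M : zmodType) (m : M) : m != 0 ->
  exists h : {additive M -> rat_mod_int}, h m != 0.
Proof.
move=> m0.
have hI : subgroup [set k | m *~ k = 0].
  by split=> [|j k /= mj mk]; rewrite ?mulr0z // mulrzBr mj mk subr0.
have [n [/= mn In]] := int_subgroup_principal hI.
(* [n] is the order of [m], with 0 for infinite order. In that case the value at [m] is free and 1/2
   is taken; otherwise it is 1/n, where [m != 0] excludes [n = 1]. *)
pose c : rat := if n is 0%N then 2%:R^-1 else n%:R^-1.
have cP : c \isn't a Num.int.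
  have inv_nint k : (1 < k)%N -> (k%:R^-1 : rat) \isn't a Num.int.
    move=> k1; rewrite intrEge0 ?invr_ge0 ?ler0n //.
    apply/negP => /natrP[j jE].
    have : (k%:R : rat) * j%:R = 1 by rewrite -jE mulfV // pnatr_eq0 -lt0n ltnW.
    rewrite -natrM => /eqP; rewrite pnatr_eq1 muln_eq1 => /andP[/eqP k1' _].
    by rewrite k1' in k1.
  rewrite /c; case: n mn {In c} => [|[|n]] mn; [exact: inv_nint| |exact: inv_nint].
  by move: m0; rewrite -[m]mulr1z mn eqxx.
have cI k : m *~ k = 0 -> c *~ k \is a Num.int.
  move=> /In[q ->]; rewrite /c; case: n {mn In c cP} => [|n].
    by rewrite mulr0 mulr0z rpred0.
  rewrite mulrC mulrzA -pmulrn -[_^-1 *+ _]mulr_natr mulVf ?pnatr_eq0 //.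
pose G := [set u | exists k, u = (m *~ k, rat_class (c *~ k))].
have hG : subgroup G.
  split; first by exists 0; rewrite !mulr0z raddf0.
  by move=> _ _ [j ->] [k ->]; exists (j - k); rewrite !mulrzBr raddfB.
have [|h hP] := divisible_graph_extension divisible_rat_mod_int hG.
  by move=> y [k [/esym mk ->]]; apply/rat_class_eq0; apply: cI.
exists h; rewrite (hP m (rat_class c)); last by exists 1; rewrite !mulr1z.
by apply/eqP => /rat_class_eq0; apply/negP.
Qed.

Section Coinduced.
Variables (R : comPzRingType) (D : zmodType).

Definition additive_pred : {pred (R -> D)} := fun f => `[< zmod_morphism f >].

Fact additive_pred_closed : zmod_closed additive_pred.
Proof.
split=> [|f g /asboolP fB /asboolP gB]; apply/asboolP => x y.
  exact: esym (subr0 0).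
by rewrite !fctE fB gB !opprD !opprK addrACA.
Qed.

HB.instance Definition _ :=
  GRing.isZmodClosed.Build (R -> D) additive_pred additive_pred_closed.

(* Hom_Z(R, D), with R acting through its multiplication. *)
Record coinduced :=
  Coinduced { coind_val :> R -> D; coind_valP : coind_val \in additive_pred }.

HB.instance Definition _ := [isSub for coind_val].
HB.instance Definition _ := [Choice of coinduced by <:].
HB.instance Definition _ := [SubChoice_isSubZmodule of coinduced by <:].

Fact coind_scale_subproof a (f : coinduced) : (fun r => f (r * a)) \in additive_pred.
Proof.
by apply/asboolP => x y; rewrite mulrBl; case: f => f /= /asboolP ->.
Qed.

Definition coind_scale a f := Coinduced (coind_scale_subproof a f).

Lemma coind_eqP (f g : coinduced) : f =1 g -> f = g.
Proof. by move=> fg; apply/val_inj/funext. Qed.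

Lemma coindB (f : coinduced) x y : f (x - y) = f x - f y.
Proof. by case: f => f /= /asboolP. Qed.

Lemma coind0 (f : coinduced) : f 0 = 0.
Proof. by rewrite -{1}(subrr (0 : R)) coindB subrr. Qed.

Lemma coindD (f : coinduced) x y : f (x + y) = f x + f y.
Proof. by rewrite -{1}[y]opprK coindB -{1}(sub0r y) coindB coind0 sub0r opprK. Qed.

Fact coind_scalerA a b f : coind_scale a (coind_scale b f) = coind_scale (a * b) f.
Proof. by apply: coind_eqP => r /=; rewrite mulrA. Qed.

Fact coind_scale1r : left_id 1 coind_scale.
Proof. by move=> f; apply: coind_eqP => r /=; rewrite mulr1. Qed.

Fact coind_scalerDr : right_distributive coind_scale +%R.
Proof. by move=> a f g; apply: coind_eqP. Qed.

Fact coind_scalerDl f : {morph coind_scale^~ f : a b / a + b}.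
Proof. by move=> a b; apply: coind_eqP => r /=; rewrite mulrDr coindD. Qed.

HB.instance Definition _ := GRing.Zmodule_isLmodule.Build R coinduced
  coind_scalerA coind_scale1r coind_scalerDr coind_scalerDl.

(** One half of the adjunction between restriction of scalars to Z and coinduction. *)
Lemma coind_linear (B : lmodType R) (h : {additive B -> D}) :
  exists H : {linear B -> coinduced}, forall b r, H b r = h (r *: b).
Proof.
have hadd b : (fun r => h (r *: b)) \in additive_pred.
  by apply/asboolP => x y; rewrite scalerBl raddfB.
have Hlin : linear (fun b => Coinduced (hadd b)).
  move=> a x y; apply: coind_eqP => r /=.
  by rewrite scalerDr raddfD scalerA.
by exists (linear_of Hlin).
Qed.

(** By adjunction, extending [g] amounts to extending the additive map [a |-> g a 1]. *)
Lemma coinduced_injective : divisible D -> injective_module coinduced.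
Proof.
move=> divD A B i g inj_i.
pose G := [set u | exists a, u = (i a, g a 1)].
have hG : subgroup G.
  split; first by exists 0; rewrite !raddf0.
  by move=> _ _ [a ->] [b ->]; exists (a - b); rewrite !raddfB.
have [|h hP] := divisible_graph_extension divD hG.
  move=> y [a [ia0 ->]].
  have -> : a = 0 by apply: inj_i; rewrite -ia0 raddf0.
  by rewrite raddf0.
have [H HE] := coind_linear h; exists H => a.
apply: coind_eqP => r; rewrite HE -linearZ (hP _ (g (r *: a) 1)); last by exists (r *: a).
by rewrite linearZ /= mul1r.
Qed.

End Coinduced.

(** The power of Q/Z is indexed by all characters of [M]; injectivity holds because they separate
    points. *)
Lemma embeds_in_injective (R : comPzRingType) (M : lmodType R) :
  exists (E : lmodType R) (f : {linear M -> E}), injective_module E /\ injective f.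
Proof.
pose L := {additive M -> rat_mod_int}.
have hadd : zmod_morphism (fun m (l : L) => l m).
  by move=> x y; apply/funext => l; rewrite raddfB.
have [f fE] := coind_linear (additive_of hadd).
exists (coinduced R (L -> rat_mod_int)), f; split.
  exact/coinduced_injective/divisible_fun/divisible_rat_mod_int.
apply: raddf_inj => m fm0; apply: contrapT => /eqP /exists_character[l].
have := fE m 1; rewrite fm0 scale1r => /(congr1 (@^~ l)) /= <-.
by rewrite eqxx.
Qed.

(** * Injective hulls *)

Section SubmoduleTheory.
Variables (R : comPzRingType) (M : lmodType R).
Implicit Types (A H N V : set M).

Lemma submodule0 : submodule [set 0 : M].
Proof.
by split=> [|x y|a x] /=; [|move=> -> ->; rewrite addr0|move=> ->; rewrite scaler0].
Qed.

Lemma submoduleN N x : submodule N -> N x -> N (- x).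
Proof. by move=> [_ _ NZ] Nx; rewrite -scaleN1r; apply: NZ. Qed.

Lemma submoduleB N x y : submodule N -> N x -> N y -> N (x - y).
Proof. by move=> hN Nx Ny; have [_ ND _] := hN; apply: ND => //; apply: submoduleN. Qed.

Lemma submodule_range (A : lmodType R) (f : {linear A -> M}) : submodule (range f).
Proof.
split=> [|_ _ [x _ <-] [y _ <-]|a _ [x _ <-]].
- by exists 0; rewrite ?raddf0.
- by exists (x + y); rewrite ?raddfD.
- by exists (a *: x); rewrite ?linearZ.
Qed.

Lemma submodule_bigcup (F : set (set M)) :
    (forall X, F X -> submodule X) -> total_on F subset -> F !=set0 ->
  submodule (\bigcup_(X in F) X).
Proof.
move=> Fsub Ftot [X FX]; split; first by exists X => //; case: (Fsub X FX).
  move=> x y Ux Uy; have [Y [FY Yx Yy]] := bigcup_chain2 Ftot Ux Uy.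
  by exists Y => //; have [_ YD _] := Fsub Y FY; apply: YD.
by move=> a x [Y FY Yx]; exists Y => //; have [_ _ YZ] := Fsub Y FY; apply: YZ.
Qed.

Lemma sub_factor N (hN : submodule N) (A : lmodType R) (f : {linear A -> M}) :
    (forall a, N (f a)) ->
  exists g : {linear A -> sub_module hN}, forall a, sub_incl hN (g a) = f a.
Proof.
move=> Nf; have Pf a : f a \in sub_pred hN by apply/asboolP.
have lin : linear (fun a => SubModule (Pf a)).
  by move=> r x y; apply: val_inj; rewrite /= linearP.
by exists (linear_of lin).
Qed.

(** The last clause is maximality in usable form, read off from the submodule generated by [N] and
    [y]. *)
Lemma exists_maximal_intersecting A V :
    submodule A -> submodule V -> A `<=` V ->
  exists N, [/\ submodule N, N `&` V = A &
    forall y, ~ N y -> exists m r, [/\ N m, V (m + r *: y) & ~ A (m + r *: y)]].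
Proof.
move=> hA hV AV.
pose P := [set N : set M | submodule N /\ N `&` V `<=` A].
have [||N [AN [hN NV] maxN]] := @zorn_above _ P A; first by split=> // x [].
  move=> F FP Ftot F0; split; first by apply: submodule_bigcup => // X /FP[].
  by move=> x [[X FX Xx] Vx]; apply: (FP X FX).2.
exists N; split=> //; first by apply/seteqP; split=> // x Ax; split; auto.
move=> y Ny; apply: contrapT => noy; apply: Ny.
have [N0 ND NZ] := hN.
pose N' := [set x | exists m r, N m /\ x = m + r *: y].
have <- : N' = N; last by exists 0, 1; rewrite add0r scale1r.
apply: maxN; first by move=> x Nx; exists x, 0; rewrite scale0r addr0.
split; first split.
- by exists 0, 0; rewrite scale0r addr0.
- move=> _ _ [m [r [Nm ->]]] [m' [r' [Nm' ->]]]; exists (m + m'), (r + r').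
  by rewrite scalerDl addrACA; split=> //; apply: ND.
- move=> a _ [m [r [Nm ->]]]; exists (a *: m), (a * r).
  by rewrite scalerDr scalerA; split=> //; apply: NZ.
- move=> _ [[m [r [Nm ->]]] Vx]; apply: contrapT => nAx.
  by apply: noy; exists m, r.
Qed.

(** Essentiality on elements: it passes to unions of chains and compares submodules of [M] without
    inclusion maps. *)
Definition essential_in A H : Prop :=
  forall x, H x -> x != 0 -> exists r, A (r *: x) /\ r *: x != 0.

Lemma essential_in_trans A H V :
  essential_in A H -> essential_in H V -> essential_in A V.
Proof.
move=> AH HV x Vx x0; have [r [Hrx rx0]] := HV x Vx x0.
by have [s] := AH _ Hrx rx0; rewrite scalerA => ?; exists (s * r).
Qed.

Lemma essentialP (A : lmodType R) (f : {linear A -> M}) :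
  essential f <-> injective f /\ essential_in (range f) setT.
Proof.
split=> -[inj_f ess_f]; split=> //.
  move=> x _ x0; apply: contrapT => nex.
  have hN : submodule [set y | exists r, y = r *: x].
    split=> [|_ _ [r ->] [s ->]|a _ [r ->]].
    - by exists 0; rewrite scale0r.
    - by exists (r + s); rewrite scalerDl.
    - by exists (a * r); rewrite scalerA.
  have /(ess_f _ hN) N0 : [set y | exists r, y = r *: x] `&` range f = [set 0].
    apply/seteqP; split=> [_ [[r ->] fr]|_ ->].
      by apply: contrapT => /eqP rx0; apply: nex; exists r.
    by split; [exists 0; rewrite scale0r|exists 0; rewrite ?raddf0].
  have : [set y | exists r, y = r *: x] x by exists 1; rewrite scale1r.
  by rewrite N0 => /= x0'; rewrite x0' eqxx in x0.
move=> N hN N0; apply/seteqP; split=> [x Nx|_ ->]; last by case: hN.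
apply: contrapT => /eqP /(ess_f x I)[r [frx]]; case/eqP.
have [_ _ NZ] := hN.
by have : (N `&` range f) (r *: x); [split=> //; apply: NZ|rewrite N0].
Qed.

(** Transitivity of essentiality turns maximality among essential extensions of [A] into maximality
    over [H]. *)
Lemma exists_maximal_essential A : submodule A ->
  exists H, [/\ submodule H, A `<=` H, essential_in A H &
    forall V, submodule V -> H `<=` V -> essential_in H V -> V = H].
Proof.
move=> hA; pose P := [set H | submodule H /\ essential_in A H].
have [||H [AH [hH eH] maxH]] := @zorn_above _ P A.
- by split=> // x Ax x0; exists 1; rewrite scale1r.
- move=> F FP Ftot F0; split; first by apply: submodule_bigcup => // X /FP[].
  by move=> x [X FX Xx]; apply: (FP X FX).2.
exists H; split=> // V hV HV eV; apply: maxH => //; split=> //.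
exact: essential_in_trans eH eV.
Qed.

(* The retraction is built on H + C, for C maximal with C meeting H trivially; its image
   is essential over H. *)
Lemma maximal_essential_retract H : injective_module M -> submodule H ->
    (forall V, submodule V -> H `<=` V -> essential_in H V -> V = H) ->
  exists f : {linear M -> M}, range f = H /\ forall x, H x -> f x = x.
Proof.
move=> injM hH maxH; have [H0 HD HZ] := hH.
have [|C [hC CH maxC]] := exists_maximal_intersecting submodule0 hH.
  by move=> _ ->.
have [C0 CD CZ] := hC.
pose G := [set u | exists h c, [/\ H h, C c & u = (h + c, h)]].
have hG : submodule G.
  split=> [|_ _ [h [c [Hh Cc ->]]] [h' [c' [Hh' Cc' ->]]]|a _ [h [c [Hh Cc ->]]]].
  - by exists 0, 0; rewrite addr0.
  - exists (h + h'), (c + c'); split; [exact: HD|exact: CD|].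
    by congr (_, _); rewrite /= addrACA.
  - exists (a *: h), (a *: c); split; [exact: HZ|exact: CZ|].
    by congr (_, _); rewrite /= scalerDr.
have [|f fP] := injective_graph_extension injM hG.
  move=> _ [h [c [Hh Cc [/esym/eqP + ->]]]]; rewrite addr_eq0 => /eqP hc.
  have : (C `&` H) h by split=> //; rewrite hc; apply: submoduleN.
  by rewrite CH.
have fH h : H h -> f h = h by move=> Hh; apply: fP; exists h, 0; rewrite addr0.
have fC c : C c -> f c = 0 by move=> Cc; apply: fP; exists 0, c; rewrite add0r.
exists f; split=> //; apply: maxH; first exact: submodule_range.
  by move=> h Hh; exists h => //; apply: fH.
move=> _ [y _ <-] fy0.
(* By maximality of [C], some [c + r *: y] is a nonzero element of [H]. As [f] fixes [H] and kills
   [c], this element is [r *: f y]. *)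
have [|c [r [Cc Hcy cy0]]] := maxC y; first by move=> /fC fy; rewrite fy eqxx in fy0.
have fE : r *: f y = c + r *: y.
  by rewrite -[RHS]fH // linearD linearZ /= (fC c) // add0r.
by exists r; rewrite fE; split=> //; apply/eqP.
Qed.

End SubmoduleTheory.

(** A maximal essential extension of [M] inside an injective module is a retract of it, hence
    injective. *)
Lemma exists_injective_hull (R : comPzRingType) (M : lmodType R) :
  exists (E : lmodType R) (f : {linear M -> E}), injective_hull f.
Proof.
have [E0 [f0 [injE0 inj_f0]]] := embeds_in_injective M.
have [H [hH f0H eH maxH]] := exists_maximal_essential (submodule_range f0).
have [p [pH pid]] := maximal_essential_retract injE0 hH maxH.
have [|f fE] := sub_factor hH (f := f0); first by move=> a; apply: f0H; exists a.
exists (sub_module hH), f; split.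
  move=> A B i g inj_i.
  have [h hE] := injE0 _ _ i (sub_incl hH \o g) inj_i.
  have [|q qE] := sub_factor hH (f := p); first by move=> a; rewrite -pH; exists a.
  exists (q \o h) => a; apply: (@sub_incl_inj _ _ _ hH).
  by rewrite qE hE pid //; apply: sub_inclP.
apply: (essentialP f).2; split.
  by move=> x y /(congr1 (sub_incl hH)); rewrite !fE => /inj_f0.
move=> x _ x0; have [|r [[m _ mE] rx0]] := eH _ (sub_inclP x).
  by apply: contra_neq x0 => x0; apply: (@sub_incl_inj _ _ _ hH); rewrite x0 raddf0.
exists r; split.
  by exists m => //; apply: (@sub_incl_inj _ _ _ hH); rewrite fE mE linearZ.
by apply: contra_neq rx0 => rx0; rewrite -linearZ rx0 raddf0.
Qed.

(** * Torsion *)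

Section Primes.
Variables (R : comPzRingType) (p : set R).
Hypothesis hp : prime_ideal p.

Lemma prime_notM a b : ~ p a -> ~ p b -> ~ p (a * b).
Proof. by have [_ _ pM] := hp => na nb /pM[]. Qed.

Lemma prime_not1 : ~ p 1.
Proof. by case: hp. Qed.

Lemma prime_not_prod n (t : 'I_n -> R) : (forall i, ~ p (t i)) -> ~ p (\prod_i t i).
Proof.
move=> nt; apply: (big_ind (fun x => ~ p x)) => //; first exact: prime_not1.
exact: prime_notM.
Qed.

Lemma ideal_exp_pow a n : p a -> ideal_exp p n (a ^+ n).
Proof.
move=> pa; elim: n => [|n IH] //= I hI; apply; exists a, (a ^+ n).
by rewrite exprS.
Qed.

End Primes.

(** The union of the chain is finitely generated, and its generators all lie in one [I n]. *)
Lemma noetherian_acc (R : comPzRingType) (I : nat -> set R) :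
    noetherian R -> (forall n, ideal (I n)) -> (forall n, I n `<=` I n.+1) ->
  exists n, I n.+1 `<=` I n.
Proof.
move=> hR hI Imono.
have Ile m n : (m <= n)%N -> I m `<=` I n.
  move=> mn; rewrite -(subnKC mn); elim: (n - m)%N => [|k IH]; first by rewrite addn0.
  by rewrite addnS => x /IH; apply: Imono.
have hU : ideal (\bigcup_n I n).
  split; first by exists 0%N => //; case: (hI 0%N).
    move=> a b [m _ Ia] [n _ Ib]; exists (maxn m n) => //.
    have [_ ID _] := hI (maxn m n).
    by apply: ID; [apply: Ile Ia; exact: leq_maxl|apply: Ile Ib; exact: leq_maxr].
  by move=> r a [m _ Ia]; exists m => //; have [_ _ IM] := hI m; apply: IM.
have [k [g gE]] := hR _ hU.
have gU i : exists n, I n (g i).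
  have : (\bigcup_n I n) (g i).
    rewrite gE; exists (fun j => (j == i)%:R).
    rewrite (bigD1 i) //= eqxx mul1r big1 ?addr0 // => j /negPf ->.
    by rewrite mul0r.
  by case=> n; exists n.
have [m mP] := choice gU.
exists (\max_i m i)%N => x Ix.
have : (\bigcup_n I n) x by exists (\max_i m i).+1.
rewrite gE => -[c ->]; have [I0 ID IM] := hI (\max_i m i)%N.
apply: (big_ind (I (\max_i m i)%N)) => // i _; apply: IM.
by apply: Ile (mP i); exact: leq_bigmax.
Qed.

Section Torsion.
Variables (R : comPzRingType) (p : set R) (M : lmodType R).
Hypothesis hR : noetherian R.
Hypothesis idp : ideal p.
Implicit Types (x : M) (N : set M).

Lemma submodule_colon (I : set R) : submodule (colon I M).
Proof.
split=> [a _|x y Ix Iy a Ia|r x Ix a Ia]; first by rewrite scaler0.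
  by rewrite scalerDr Ix // Iy // addr0.
by rewrite scalerA mulrC -scalerA Ix // scaler0.
Qed.

Lemma colon_exp0 x : colon (ideal_exp p 0) M x -> x = 0.
Proof. by move=> /(_ 1 I); rewrite scale1r. Qed.

Lemma colon_expS n x : colon (ideal_exp p n.+1) M x <->
  forall a, p a -> colon (ideal_exp p n) M (a *: x).
Proof.
split=> [Cx a pa b pb|Cx c pc].
  rewrite scalerA mulrC; apply: Cx => J hJ; apply; exists a, b; by [].
(* The product ideal is the least ideal containing the products, so it is tested against the
   annihilator of [x]. *)
apply: (pc [set c | c *: x = 0]).
  split=> [|a b /= ax bx|r a /= ax]; first by rewrite /= scale0r.
    by rewrite scalerDl ax bx addr0.
  by rewrite -scalerA ax scaler0.
by move=> _ [a [b [pa pb ->]]] /=; rewrite mulrC -scalerA Cx.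
Qed.

Lemma colon_exp_le m n x :
  (m <= n)%N -> colon (ideal_exp p m) M x -> colon (ideal_exp p n) M x.
Proof.
move=> mn; rewrite -(subnKC mn); elim: (n - m)%N x => [|k IH] x; first by rewrite addn0.
rewrite addnS => Cx; apply/colon_expS => a _; apply: IH.
by have [_ _ CZ] := submodule_colon (ideal_exp p m); apply: CZ.
Qed.

(** Reducing to finitely many generators lets their exponents or denominators be combined. *)
Lemma noetherian_generators :
  exists (k : nat) (g : 'I_k -> R), (forall i, p (g i)) /\
    forall N x, submodule N -> (forall i, N (g i *: x)) -> forall a, p a -> N (a *: x).
Proof.
have [k [g gE]] := hR idp; exists k, g; split=> [i|N x [N0 ND NZ] Nx a].
  rewrite gE; exists (fun j => (j == i)%:R).
  rewrite (bigD1 i) //= eqxx mul1r big1 ?addr0 // => j /negPf ->.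
  by rewrite mul0r.
rewrite gE => -[c ->]; rewrite scaler_suml.
by apply: (big_ind N) => // i _; rewrite -scalerA; apply: NZ.
Qed.

(** Let [g i ^+ m i] kill [x] for each generator. Passing to [g i *: x] lowers a positive [m i] by
    one, so the induction is on a bound for the sum of the exponents. *)
Lemma nilpotent_colon_exp x :
    (forall a, p a -> exists m, a ^+ m *: x = 0) ->
  exists n, colon (ideal_exp p n) M x.
Proof.
move=> nilx; have [k [g [pg gN]]] := noetherian_generators.
have [m mP] := choice (fun i => nilx _ (pg i)).
(* The extra 1 matters when [p] is zero: without generators the sum is 0, and [x] need not
   vanish. *)
exists (\sum_i m i).+1; move: mP.
move: {-1}(\sum_i m i)%N (leqnn (\sum_i m i)) => n.
elim: n m x {nilx} => [|n IH] m x mn mP; apply/colon_expS; apply: gN;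
    try exact: submodule_colon; move=> i.
  have mi0 : m i = 0%N.
    by apply/eqP; rewrite -leqn0 (leq_trans _ mn) // (bigD1 i) //= leq_addr.
  by have := mP i; rewrite mi0 scale1r => ->; rewrite scaler0 => a _; rewrite scaler0.
case mi : (m i) => [|mi'].
  by have := mP i; rewrite mi scale1r => -> a _; rewrite !scaler0.
apply: (IH (fun j => if j == i then mi' else m j)).
  move: mn; rewrite (bigD1 i) //= mi [in X in _ -> X](bigD1 i) //= eqxx addSn ltnS.
  by rewrite [X in _ -> (_ + X <= _)%N](eq_bigr m) // => j /negPf ->.
move=> j; case: eqP => [->|_].
  by rewrite scalerA -exprSr -mi mP.
by rewrite scalerA mulrC -scalerA mP scaler0.
Qed.

(** For [a] in [p] the annihilators of the [a ^+ n *: x] have a stationary step. There a nonzero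
    [a ^+ n *: x] would have a nonzero multiple by some [r] killed by [a], and [r] would already
    annihilate [a ^+ n *: x]. *)
Lemma essential_colon_torsion x :
  essential_in (colon p M) setT -> exists n, colon (ideal_exp p n) M x.
Proof.
move=> ess; apply: nilpotent_colon_exp => a pa.
have [||n In] := @noetherian_acc R (fun n => [set r | r *: (a ^+ n *: x) = 0]) hR.
- move=> n; split=> [|r s /= rx sx|r s /= sx]; first by rewrite /= scale0r.
    by rewrite scalerDl rx sx addr0.
  by rewrite -scalerA sx scaler0.
- by move=> n r /= rx; rewrite exprS -scalerA scalerA mulrC -scalerA rx scaler0.
exists n; apply: contrapT => /eqP /(ess _ I)[r [rC /eqP]]; apply.
apply: In; rewrite /= exprS -scalerA scalerA mulrC -scalerA; exact: rC.
Qed.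

(** Induction on the exponent: if some [a] in [p] does not kill [x], then [a *: x] has a smaller
    exponent. *)
Lemma torsion_essential_colon :
    (forall x, exists n, colon (ideal_exp p n) M x) ->
  essential_in (colon p M) setT.
Proof.
move=> tors x _; have [n] := tors x; elim: n x => [|n IH] x.
  by move=> /colon_exp0 ->; rewrite eqxx.
move=> /colon_expS Cx x0; have [Cpx|/existsNP[a]] := pselect (colon p M x).
  by exists 1; rewrite scale1r.
move=> /not_implyP[pa /eqP ax0].
have [r] := IH _ (Cx a pa) ax0.
by rewrite scalerA; exists (r * a).
Qed.

End Torsion.

(** * The injective hull of R/p *)

Lemma submodule_ideal (R : comPzRingType) (p : set R) :
  ideal p -> submodule (p : set R^o).
Proof. by []. Qed.

Section Residue.
Variables (R : comPzRingType) (p : set R).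
Hypotheses (hR : noetherian R) (hp : prime_ideal p).

Let idp : ideal p := let: And3 h _ _ := hp in h.

Definition residue_module : lmodType R := quot_module (submodule_ideal idp).

(** [u] is the image of 1, so its multiples form the copy of R/p in [E]. *)
Lemma exists_residue_hull :
  exists (E : lmodType R) (u : E), [/\ injective_module E,
    forall r, r *: u = 0 <-> p r & essential_in [set x | exists r, x = r *: u] setT].
Proof.
have [E [f [injE /essentialP[inj_f ess_f]]]] := exists_injective_hull residue_module.
pose q (r : R^o) : residue_module := quot_mk (submodule_ideal idp) r.
have qE r : q r = r *: q 1.
  by rewrite /q -linearZ /= [_ *: _]mulr1.
exists E, (f (q 1)); split=> // [r|x _ x0].
  rewrite -linearZ -qE; split=> [|pr].
    rewrite -[RHS](raddf0 f) => /inj_f; exact: (quot_mk_eq0 (submodule_ideal idp) r).1.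
  by rewrite /q (quot_mk_eq0 (submodule_ideal idp) r).2 // raddf0.
have [r [[y _ yE] rx0]] := ess_f x I x0; exists r; split=> //=.
have [s sE] := quot_mk_surj y; exists s.
by rewrite -yE -linearZ -qE -sE.
Qed.

Variables (E : lmodType R) (u : E).
Hypotheses (injE : injective_module E) (annu : forall r, r *: u = 0 <-> p r).
Let A := [set x | exists r, x = r *: u].
Hypothesis essu : essential_in A setT.

(** A nonzero [x] has a nonzero multiple in R/p, where [t] acts injectively because [p] is prime. *)
Lemma residue_hull_regular t (x : E) : ~ p t -> t *: x = 0 -> x = 0.
Proof.
move=> npt tx0; apply: contrapT => /eqP /(essu I)[r [[s rx] /eqP]].
rewrite rx => su0; apply: (prime_notM hp npt (b := s)); last first.
  by apply/annu; rewrite -scalerA -rx scalerA mulrC -scalerA tx0 scaler0.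
by move=> /annu.
Qed.

Lemma residue_hull_sub_colon : A `<=` colon p E.
Proof.
by move=> _ [r ->] a pa; rewrite scalerA mulrC -scalerA (annu a).2 // scaler0.
Qed.

(** Thus (0 :_E p) and R/p agree after localization at [p]. If [r *: x] is nonzero in R/p, then [r]
    is outside [p], since [p] kills [x]. *)
Lemma residue_hull_colon (x : E) : colon p E x -> exists t, ~ p t /\ A (t *: x).
Proof.
move=> Cx; have [->|/eqP x0] := pselect (x = 0).
  exists 1; split; first exact: prime_not1 hp.
  by exists 0; rewrite scaler0 scale0r.
have [r [Arx rx0]] := essu I x0; exists r; split=> // pr.
by rewrite Cx // eqxx in rx0.
Qed.

Lemma residue_hull_torsion (x : E) : exists n, colon (ideal_exp p n) E x.
Proof.
apply: essential_colon_torsion => // y _ y0; have [r [Ary ry0]] := essu I y0.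
by exists r; split=> //; apply: residue_hull_sub_colon.
Qed.

(* [N] and [E] have the same localization at [p]. *)
Lemma residue_hull_dense (N : set E) : submodule N -> N `&` colon p E = A ->
    (forall y, ~ N y -> exists m r,
       [/\ N m, colon p E (m + r *: y) & ~ A (m + r *: y)]) ->
  forall x, exists t, ~ p t /\ N (t *: x).
Proof.
move=> hN NA maxN x; have [N0 ND NZ] := hN.
have AN : A `<=` N by rewrite -NA => y [].
have [n] := residue_hull_torsion x; elim: n x => [|n IH] x.
  move=> /colon_exp0 ->; exists 1; split; first exact: prime_not1 hp.
  by rewrite scaler0.
move=> /colon_expS Cx.
have [k [g [pg gN]]] := noetherian_generators E hR idp.
have [t tP] := choice (fun i => IH _ (Cx _ (pg i))).
(* A common denominator, which brings all of p x into [N]. *)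
pose T := \prod_i t i.
have npT : ~ p T by apply: prime_not_prod => // i; case: (tP i).
have pz a : p a -> N (a *: (T *: x)).
  apply: gN => // i; rewrite scalerA mulrC -scalerA /T (bigD1 i) //=.
  by rewrite mulrC -scalerA; apply: NZ; case: (tP i).
have [Nz|/maxN[m [r [Nm Cmr nAmr]]]] := pselect (N (T *: x)); first by exists T.
(* If [r] were in [p], the element [m + r *: (T *: x)] would lie in [N] and in (0 :_E p), hence in
   [A]. *)
have npr : ~ p r.
  by move=> /pz Nrz; apply: nAmr; rewrite -NA; split=> //; apply: ND.
have [s [nps /AN]] := residue_hull_colon Cmr.
rewrite scalerDr => Ns; exists (s * r * T); split.
  by apply: prime_notM => //; apply: prime_notM.
have -> : (s * r * T) *: x = (s *: m + s *: (r *: (T *: x))) - s *: m.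
  by rewrite addrC addKr !scalerA.
by apply: submoduleB => //; apply: NZ.
Qed.

(** This is the faithfulness of E_p over R_p. If there were no such [t], the map [r * a |-> r *: u]
    would be well defined and extend to some [h] on R, giving [u = a *: h 1 = 0]. *)
Lemma residue_hull_annihilator a :
  (forall x : E, a *: x = 0) -> exists t, ~ p t /\ t * a = 0.
Proof.
move=> aE0; apply: contrapT => nt.
pose G : set (R^o * E) := [set v | exists r : R, v = (r * a, r *: u)].
have hG : submodule G.
  split; first by exists 0; rewrite mul0r scale0r.
    move=> _ _ [r ->] [s ->]; exists (r + s).
    by congr (_, _); rewrite /= ?mulrDl ?scalerDl.
  by move=> b _ [r ->]; exists (b * r); congr (_, _); rewrite /= ?scalerA // -mulrA.
have [|h hP] := injective_graph_extension injE hG.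
  move=> _ [r [ra0 ->]]; apply/annu; apply: contrapT => npr.
  by apply: nt; exists r.
have : h a = u by apply: hP; exists 1; rewrite mul1r scale1r.
have -> : h a = a *: h (1 : R^o) by rewrite -linearZ /= [_ *: _]mulr1.
rewrite aE0 => u0; apply: (prime_not1 hp).
by apply/annu; rewrite -u0 scaler0.
Qed.

End Residue.

(** * Support and the Melkersson condition: the two inclusions *)

Section Subcategories.
Variables (R : comPzRingType) (S : lmodType R -> Prop).
Hypotheses (hR : noetherian R) (hS : serre S).

Lemma Sfg_extension (M : lmodType R) : Sfg M -> extension_subcat (@Sfg R) S M.
Proof.
move=> fgM; have hT : submodule [set: M] by [].
exists M, (quot_module hT), idfun, (quot_mk hT); split=> //.
  split=> //.
    by rewrite image_id; apply/seteqP; split=> // x _; apply/quot_mk_eq0.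
  by apply/seteqP; split=> // y _; have [x <-] := quot_mk_surj y; exists x.
by apply: serre_zero => // z; have [x <-] := quot_mk_surj z; apply/quot_mk_eq0.
Qed.

Lemma serre_extension (M : lmodType R) : S M -> extension_subcat (@Sfg R) S M.
Proof.
move=> SM; exists (sub_module (submodule0 M)), M, (sub_incl (submodule0 M)), idfun.
split=> //.
  split; first exact: sub_incl_inj.
    by rewrite range_sub_incl; apply/seteqP; split.
  by rewrite image_id.
exists 0%N, (fun=> 0) => x; exists (fun=> 0); rewrite big_ord0.
by apply: (@sub_incl_inj _ _ _ (submodule0 M)); rewrite raddf0; exact: (sub_inclP x).
Qed.

(** Such an [x] is the numerator of a difference of two fractions; conversely [x] and 0 are compared
    over the denominator 1. *)
Lemma Supp_not0 (p : set R) (M : lmodType R) : prime_ideal p ->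
  Supp M p <-> exists x : M, forall t, ~ p t -> t *: x <> 0.
Proof.
move=> hp; split=> [[_ [u [v nuv]]]|[x xP]].
  exists (sval v.2 *: u.1 - sval u.2 *: v.1) => t npt tx0.
  by apply: nuv; exists t.
split=> //.
pose one : {s : R | ~ p s} := exist _ 1 (prime_not1 hp).
exists (x, one), (0, one) => -[t [npt /=]].
by rewrite !scale1r subr0; apply: xP.
Qed.

Section Prime.
Variable p : set R.
Hypothesis hp : prime_ideal p.
Let idp : ideal p := let: And3 h _ _ := hp in h.

Lemma melkersson_Supp :
  height_ge p 1 -> melkersson (extension_subcat (@Sfg R) S) p -> Supp_subcat S p.
Proof.
move=> [m [q [m1 [qprime qlt qm]]]] mel; apply: contrapT => nSupp.
have Sloc (B : lmodType R) (b : B) : S B -> exists t, ~ p t /\ t *: b = 0.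
  move=> SB; apply: contrapT => nt; apply: nSupp; exists B; split=> //.
  by apply/(Supp_not0 _ hp); exists b => t npt tb0; apply: nt; exists t.
have [E [u [injE annu essu]]] := exists_residue_hull hp.
have Acolon := residue_hull_sub_colon annu.
have hA : submodule [set x | exists r, x = r *: u].
  split=> [|_ _ [r ->] [s ->]|a _ [r ->]].
  - by exists 0; rewrite scale0r.
  - by exists (r + s); rewrite scalerDl.
  - by exists (a * r); rewrite scalerA.
have [N [hN NA maxN]] :=
  exists_maximal_intersecting hA (submodule_colon E p) Acolon.
have tors := residue_hull_torsion hR hp annu essu.
have dense := residue_hull_dense hR hp annu essu hN NA maxN.
pose i := sub_incl hN.
have GN : Gamma p (sub_module hN) = [set: sub_module hN].
  (* [Gamma] asks for a positive exponent, hence [n.+1]. *)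
  apply/seteqP; split=> // y _; have [n /(colon_exp_le (leqnSn n)) Cn] := tors (i y).
  exists n.+1; split=> // a pa; apply: (@sub_incl_inj _ _ _ hN).
  by rewrite linearZ raddf0; apply: Cn.
(* (0 :_N p) is the intersection of [N] with (0 :_E p), so it is cyclic, generated by [u]. *)
have fgC : Sfg (colon_module p (sub_module hN)).
  have [Nu Cu] : (N `&` colon p E) u by rewrite NA; exists 1; rewrite scale1r.
  have [y _ yE] : range i u by rewrite range_sub_incl.
  have Cy : y \in colon_pred p (M := sub_module hN).
    apply/asboolP => a pa; apply: (@sub_incl_inj _ _ _ hN).
    by rewrite linearZ raddf0 -/i yE; apply: Cu.
  exists 1%N, (fun=> ColonModule Cy) => x.
  have : (N `&` colon p E) (i (colon_val x)).
    split; first exact: sub_inclP.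
    move=> a pa; rewrite -linearZ; have /asboolP -> // := colon_valP x.
  rewrite NA => -[r xE].
  exists (fun=> r); rewrite big_ord1; apply: val_inj; apply: (@sub_incl_inj _ _ _ hN).
  by rewrite -[LHS]/(i (colon_val x)) xE [val (r *: _)]/= linearZ -/i yE.
have [F [B [f [g [[_ rf _] [k [w wP]] SB]]]]] := mel _ GN (Sfg_extension fgC).
have [e eP] := choice (fun j => tors (i (f (w j)))).
pose n := (\max_j e j)%N.
have Fn x : colon (ideal_exp p n) E (i (f x)).
  have [c ->] := wP x; have [C0 CD CZ] := submodule_colon E (ideal_exp p n).
  apply: (big_ind (fun x => colon (ideal_exp p n) E (i (f x)))).
  - by rewrite !raddf0.
  - by move=> y z Cy Cz; rewrite !raddfD; apply: CD.
  - move=> j _; rewrite !linearZ; apply: CZ.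
    by apply: colon_exp_le (eP j); exact: leq_bigmax.
have Ekill a : ideal_exp p n a -> forall x : E, a *: x = 0.
  (* [t] moves [x] into [N], then [s] moves [t *: x] into the image of [F], which [a] kills. The
     product [s * t] acts injectively on [E]. *)
  move=> pna x; have [t [npt]] := dense x; rewrite -(range_sub_incl hN) => -[y _ yE].
  have [s [nps sy0]] := Sloc B (g y) SB.
  have [z _ zE] : range f (s *: y) by rewrite rf /= linearZ.
  apply: (residue_hull_regular hp annu essu (prime_notM hp nps npt)).
  rewrite scalerA mulrC -scalerA -[(s * t) *: x]scalerA -yE -[s *: _]linearZ -zE.
  exact: Fn.
(* The last step of the chain puts a prime [q m] strictly inside [p]. For [a] in [p], some [t]
   outside [p] kills [a ^+ n], so [a] lies in [q m], contradicting strictness. *)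
case: m m1 qprime qlt qm => // m _ qprime qlt qm.
have [qp []] := qlt m (ltnSn m); rewrite qm => a pa.
have [[q0 _ qZ] _ qM] := qprime m (leqnSn m).
have [t [npt ta0]] := residue_hull_annihilator hp injE annu (Ekill _ (ideal_exp_pow n pa)).
have /qM[qt|] : q m (t * a ^+ n) by rewrite ta0.
  by case: npt; rewrite -qm; apply: qp.
elim: n {Fn Ekill ta0} => [|n IH]; first by move=> q1; rewrite -[a]mulr1; apply: qZ.
by rewrite exprS => /qM[].
Qed.

(** The element [z] given by the support has its annihilator inside [p], so R/p is a quotient of the
    submodule generated by [z]. *)
Lemma residue_module_in_serre : Supp_subcat S p -> S (residue_module hp).
Proof.
move=> [M [SM /(Supp_not0 _ hp)[z zP]]].
pose q (r : R^o) : residue_module hp := quot_mk (submodule_ideal idp) r.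
apply: (serre_subquotient hS (G := [set v | exists r, v = (r *: z, q r)])) SM.
- split=> [|_ _ [r ->] [s ->]|a _ [r ->]].
  + by exists 0; rewrite scale0r /q raddf0.
  + by exists (r + s); congr (_, _); rewrite /= ?scalerDl // /q raddfD.
  + by exists (a * r); congr (_, _); rewrite /= ?scalerA // /q -linearZ.
- move=> _ [r [rz0 ->]]; apply/quot_mk_eq0; apply: contrapT => npr.
  exact: (zP r npr).
- by move=> b; have [r <-] := quot_mk_surj b; exists (r *: z), r.
Qed.

(** Generated by [n] elements and killed by [p], [F] is a quotient of (R/p)^n. *)
Lemma serre_fg_annihilated (F : lmodType R) : S (residue_module hp) -> Sfg F ->
  (forall a (x : F), p a -> a *: x = 0) -> S F.
Proof.
move=> SQ [n [g gP]] pF.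
pose q (r : R^o) : residue_module hp := quot_mk (submodule_ideal idp) r.
apply: (serre_subquotient hS (A := 'I_n -> residue_module hp)
  (G := [set v | exists c : 'I_n -> R, v = (fun i => q (c i), \sum_i c i *: g i)]));
  last exact: serre_power.
- split=> [|_ _ [c ->] [d ->]|a _ [c ->]].
  + exists (fun=> 0); congr (_, _).
      by apply/funext => i; rewrite /q raddf0.
    by rewrite big1 // => i _; rewrite scale0r.
  + exists (fun i => c i + d i); congr (_, _).
      by apply/funext => i; rewrite /q raddfD.
    by rewrite /= -big_split; apply: eq_bigr => i _; rewrite scalerDl.
  + exists (fun i => a * c i); congr (_, _).
      by apply/funext => i; rewrite /q -[_ * _]/(_ *: _) linearZ.
    by rewrite /= scaler_sumr; apply: eq_bigr => i _; rewrite scalerA.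
- move=> _ [c [c0 ->]]; rewrite big1 // => i _; apply: pF.
  by apply/(quot_mk_eq0 (submodule_ideal idp)); have := congr1 (@^~ i) c0.
- by move=> x; have [c ->] := gP x; exists (fun i => q (c i)), c.
Qed.

Lemma Supp_melkersson : closed_injective_hull S -> Supp_subcat S p ->
  melkersson (extension_subcat (@Sfg R) S) p.
Proof.
move=> Shull Sp M GM [F [B [f [g [exact_fg fgF SB]]]]].
apply: serre_extension.
have inj_f : injective f by case: exact_fg.
have SF : S F.
  apply: serre_fg_annihilated => //; first exact: residue_module_in_serre.
  move=> a x pa; apply: inj_f; rewrite linearZ raddf0; apply: val_inj.
  by have /asboolP := colon_valP (f x); apply.
have SC : S (colon_module p M) := serre_ext hS exact_fg SF SB.
have [E [h [injE /essentialP[inj_h ess_h]]]] := exists_injective_hull M.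
pose v : {linear colon_module p M -> M} := \val.
have rv : range v = colon p M.
  apply/seteqP; split=> [_ [x _ <-]|x Cx].
    by have /asboolP := colon_valP x.
  have Px : x \in colon_pred p (M := M) by apply/asboolP.
  by exists (ColonModule Px).
have SE : S E.
  (* Essentiality is transitive: [E] is essential over [M], and [M], being p-torsion, over (0 :_M
     p). *)
  apply: (Shull _ _ (h \o v)) SC; split=> //.
  apply: (essentialP _).2; split; first exact: inj_comp inj_h val_inj.
  apply: essential_in_trans ess_h => _ [x _ <-] hx0.
  have [||r [Crx rx0]] := torsion_essential_colon (p := p) (M := M) _ (x := x) I.
  - move=> y; have : Gamma p M y by rewrite GM.
    by case=> n [_ Cn]; exists n.
  - by apply: contra_neq hx0 => ->; rewrite raddf0.
  exists r; split.
    move: Crx; rewrite -rv => -[y _ yE]; exists y => //.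
    by rewrite /= -linearZ -yE.
  apply: contra_neq rx0 => rx0; apply: inj_h.
  by rewrite linearZ /= rx0 raddf0.
exact: (serre_sub hS inj_h).
Qed.

End Prime.
End Subcategories.

Theorem mainTheorem1 (R : comPzRingType) (hR : noetherian R)
    (S : lmodType R -> Prop) (hS : serre S) :
  [set p : set R | MM (extension_subcat (@Sfg R) S) p /\ height_ge p 1]
    `<=` [set p : set R | Supp_subcat S p /\ height_ge p 1] /\
  (closed_injective_hull S ->
   [set p : set R | MM (extension_subcat (@Sfg R) S) p /\ height_ge p 1]
     = [set p : set R | Supp_subcat S p /\ height_ge p 1]).
Proof.
have sub : [set p : set R | MM (extension_subcat (@Sfg R) S) p /\ height_ge p 1]
    `<=` [set p : set R | Supp_subcat S p /\ height_ge p 1].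
  by move=> p [[hp mel] htp]; split=> //; apply: melkersson_Supp.
split=> // Shull; apply/seteqP; split=> // p [Sp htp]; split=> //.
have hp : prime_ideal p by case: Sp => M [_ []].
by split=> //; apply: Supp_melkersson.
Qed.
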